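(* Let $d\ge2$ and let $\mathcal{P}(L)$ be an $n$-element lattice point set in $[0,1)^d$. Then \[ D_{\mathcal{K}}\big(\mathcal{P}(L)\big)\ge\min\Big\{\frac{1}{2\sqrt d+1},\frac{c_d}{n^{1/d}}\Big\},\qquad\text{where } c_d:=\frac{\sqrt\pi}{2\sqrt d+1}\Big(\Gamma\Big(\frac d2+1\Big)\Big)^{-1/d}. \] If additionally $\sigma(L)\le1/2$, then $c_d$ may be replaced by $c_d'=c\,\big(\Gamma(\frac d2+1)\big)^{-1/d}$ for some $c>0$ that is independent of $d$.
   Context: A $d$-dimensional lattice is $L=\{\sum_{i=1}^d k_ib_i:k_i\in\mathbb{Z}\}$ with $b_1,\dots,b_d\in\mathbb{R}^d$ linearly independent. It is an integration lattice if $\mathbb{Z}^d\subset L$, and then it generates the lattice point set $\mathcal{P}(L)=L\cap[0,1)^d$. The isotropic discrepancy of an $n$-point set $P_n\subset[0,1)^d$ is $D_{\mathcal{K}}(P_n)=\sup_{K\in\mathcal{K}}\big|\frac{\#(K\cap P_n)}{n}-\mathrm{vol}(K)\big|$, where $\mathcal{K}$ is the class of all convex sets contained in $[0,1)^d$ and $\mathrm{vol}$ is Lebesgue measure. The dual lattice is $L^\bot=\{h\in\mathbb{R}^d:\langle h,x\rangle\in\mathbb{Z}\text{ for all }x\in L\}$ and the spectral test is $\sigma(L)=1/\min\{\|h\|_2:h\in L^\bot\setminus\{0\}\}$. The constant $c$ is also independent of $L$ and $n$. *)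

(* Defs.v *)
From HB Require Import structures.
From mathcomp Require Import all_boot all_order all_algebra.
From mathcomp Require Import finmap.
From mathcomp Require Import all_classical all_reals all_analysis.

Set Implicit Arguments.
Unset Strict Implicit.
Unset Printing Implicit Defensive.

Import Order.TTheory GRing.Theory Num.Theory.
Import numFieldNormedType.Exports.

Local Open Scope classical_set_scope.
Local Open Scope ring_scope.

Section EuclideanSpace.
Variables (R : realType) (d : nat).
Implicit Types (x y a b : 'rV[R]_d) (A : set 'rV[R]_d).

Definition dot x y : R := \sum_i x 0 i * y 0 i.

(* The norm that the library puts on 'rV[R]_d is the sup norm. *)
Definition norm2 x : R := Num.sqrt (dot x x).

Definition unit_cube : set 'rV[R]_d := [set x | forall i, 0 <= x 0 i < 1].

Definition box a b : set 'rV[R]_d := [set x | forall i, a 0 i < x 0 i <= b 0 i].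

Definition box_volume a b : R := \prod_i Num.max 0 (b 0 i - a 0 i).

(* d-dimensional Lebesgue (outer) measure: the infimum of the total volume of
   a countable cover by boxes. Lebesgue measure is its restriction to the
   Lebesgue measurable sets, among which are all convex sets (even though these
   need not be Borel). *)
Definition vol A : \bar R :=
  ereal_inf [set (\sum_(0 <= k <oo) (box_volume (ab k).1 (ab k).2)%:E)%E
            | ab in [set ab : nat -> 'rV[R]_d * 'rV[R]_d |
                      A `<=` \bigcup_k box (ab k).1 (ab k).2]].

End EuclideanSpace.

Arguments unit_cube {R d}.

Section Lattices.
Variables (R : realType) (d : nat).
Implicit Types (L : set 'rV[R]_d).

(* The basis vectors are the rows of B. *)
Definition lattice_of (B : 'M[R]_d) : set 'rV[R]_d :=
  [set x | exists k : 'I_d -> int, x = \sum_i (k i)%:~R *: row i B].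

Definition is_lattice L : Prop :=
  exists2 B : 'M[R]_d, row_free B & L = lattice_of B.

Definition integer_points : set 'rV[R]_d :=
  [set x | forall i, x 0 i \is a Num.int].

Definition integration_lattice L : Prop :=
  is_lattice L /\ integer_points `<=` L.

Definition lattice_points L : set 'rV[R]_d := L `&` unit_cube.

Definition dual_lattice L : set 'rV[R]_d :=
  [set h | forall x, L x -> dot h x \is a Num.int].

(* The infimum is a minimum, and is positive, when L is a lattice and 0 < d,
   since the dual of a lattice is again a lattice. *)
Definition spectral_test L : R :=
  (inf [set norm2 h | h in dual_lattice L `\ 0])^-1.

End Lattices.

Section Discrepancy.
Variables (R : realType) (d : nat).

(* For finite A; the value is 0 if A is infinite. *)
Definition card (A : set 'rV[R]_d) : nat := #|` fset_set A|.

Definition convex_in_cube : set (set 'rV[R]_d) :=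
  [set K | convex_set K /\ K `<=` unit_cube].

Definition isotropic_discrepancy (P : set 'rV[R]_d) : \bar R :=
  ereal_sup [set `| ((card (K `&` P))%:R / (card P)%:R)%:E - vol K |%E
            | K in convex_in_cube].

End Discrepancy.

Definition Gamma (R : realType) (s : R) : R :=
  \int[@lebesgue_measure R]_(t in `]0, +oo[) (t `^ (s - 1) * expR (- t)).

Definition Gamma_factor (R : realType) (d : nat) : R :=
  Gamma (d%:R / 2 + 1 : R) `^ (- (1 / d%:R)).

Definition c_d (R : realType) (d : nat) : R :=
  Num.sqrt pi / (2 * Num.sqrt d%:R + 1) * Gamma_factor R d.

Definition c_d' (R : realType) (c : R) (d : nat) : R := c * Gamma_factor R d.

(* Main.v *)
Require Import Defs.
From HB Require Import structures.
From mathcomp Require Import all_boot all_order all_algebra.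
From mathcomp Require Import finmap.
From mathcomp Require Import all_classical all_reals all_analysis.
From mathcomp Require Import measurable_realfun.
From mathcomp Require Import ring lra zify.

Set Implicit Arguments.
Unset Strict Implicit.
Unset Printing Implicit Defensive.

Import Order.TTheory GRing.Theory Num.Theory.
Import numFieldNormedType.Exports.

Local Open Scope ring_scope.

(** Let h be a nonzero vector of the dual lattice of L. Since L contains the
    integer points, h has integer coordinates, and all points of L lie on the
    hyperplanes <h, x> = k with k an integer. The open slab of the cube
    between two consecutive hyperplanes is convex and contains no point of L,
    so its volume bounds the discrepancy from below
    ([vol_slab_le_discrepancy]). The proof finds a slab of large volume and a
    short vector h.

    Large slabs. If [m] consecutive slabs fill a proportion [p] of the cube,
    one of them has volume at least [p / m] ([le_slab_average]). All slabs
    together fill the cube and there are exactly as many as the l1-norm of h,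
    which gives a slab of volume at least 1 / |h|_1 ([discrepancy_ge_norm1]).
    For a bound whose constant does not depend on the dimension, note that <h,
    x> has standard deviation of order |h|_2 when x is uniform in the cube; by
    Chebyshev's inequality a fixed proportion of the cube lies in O(|h|_2)
    slabs ([discrepancy_ge_norm2]). Volumes are compared with numbers of cells
    of a fine cubic grid: a set that contains [M] cells of side 1/N has outer
    measure at least M / N^d ([vol_ge_cells]), and both the covering and the
    variance argument become statements on finite sums over the cells.

    Short vectors. The group of integer points modulo the dual lattice embeds
    into L modulo the integer points, which has n elements
    ([integration_lattice_pairing], from the Smith normal form). Hence among n
    + 1 integer points two differ by a dual vector ([dual_pigeonhole]).
    Applied to the integer points of a translated cross-polytope, whose number
    is at least (s + 1)^d / d! when the l1-diameter is s ([size_l1_balls]),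
    this gives |h|_1^d <= d! n. Applied to a cube it gives |h|_oo^d <= n.

    The first bound thus yields discrepancy at least (d! n)^(-1/d). The
    constant c_d comes from Minkowski's theorem for Euclidean balls; the
    cross-polytope does at least as well because d! pi^(d/2) <= (2 sqrt d +
    1)^d Gamma(d/2 + 1) ([fact_pi_le_Gamma]). The second bound yields a
    constant times d^(-1/2) n^(-1/d), and Gamma(d/2 + 1)^(1/d) is at least a
    constant times sqrt d. Both comparisons rest on Gamma(s + 1) >= 2 (s/e)^s
    ([Gamma_ge]). *)

(** * Lattice sums over a grid of cells *)

Section GridResidues.
Variables (d : nat) (h : 'rV[int]_d).

Definition norm1 : nat := (\sum_(i < d) `|h 0%R i|)%N.

Lemma norm1_gt0 : h != 0 -> (0 < norm1)%N.
Proof.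
move=> /rV0Pn[i hi].
by rewrite /norm1 (bigD1 i)//= addn_gt0 lt0n absz_eq0 hi.
Qed.

Definition grid_dot (N : nat) (c : {ffun 'I_d -> 'I_N}) : int :=
  \sum_i h 0 i * (c i)%:Z.

Definition near_multiple (N : nat) (s : int) : bool :=
  ((s %% N%:Z)%Z <= norm1%:Z) || (N%:Z - norm1%:Z <= (s %% N%:Z)%Z).

Lemma card_coord (N : nat) (i0 : 'I_d) (A : {set 'I_N}) :
  (#|[set e : {ffun 'I_d -> 'I_N} | e i0 \in A]| = #|A| * N ^ d.-1)%N.
Proof.
pose F i j : nat := if i == i0 then (j \in A) : nat else 1%N.
have := bigA_distr_bigA (zero := 0%N) (times := muln) (one := 1%N)
  (plus := addn) F.
rewrite (bigD1 i0)//=.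
rewrite [X in (X * _)%N](_ : _ = #|A|); last first.
  rewrite -sum1_card [RHS]big_mkcond/=; apply: eq_bigr => j _.
  by rewrite /F eqxx; case: (j \in A).
rewrite [X in (_ * X)%N](_ : _ = (N ^ d.-1)%N); last first.
  rewrite (eq_bigr (fun=> N)); last first.
    by move=> i /negbTE ii0; rewrite /F ii0 sum_nat_const card_ord muln1.
  by rewrite prod_nat_const cardC1 card_ord.
move=> ->; rewrite -sum1_card [LHS]big_mkcond/=; apply: eq_bigr => e _.
rewrite inE (bigD1 i0)//= big1 => [|i /negbTE ii0]; last by rewrite /F ii0.
by rewrite /F eqxx muln1; case: (_ \in _).
Qed.

(** When [h 0 i0] is invertible modulo [N], replacing the coordinate [i0] of
    a cell by the residue of [grid_dot] is a bijection of the grid, so this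
    residue is equidistributed. Cells with a residue close to 0, which are
    the only ones that a hyperplane can cut, are therefore rare. *)
Lemma card_near_multiple (N : nat) (i0 : 'I_d) : (0 < N)%N ->
  coprimez (h 0 i0) N%:Z ->
  (#|[set c : {ffun 'I_d -> 'I_N} | near_multiple N (grid_dot c)]|
     <= (2 * norm1).+1 * N ^ d.-1)%N.
Proof.
case: N => // N _ cop.
have N0 : N.+1%:Z != 0 by [].
pose res (s : int) : 'I_N.+1 := inord `|(s %% N.+1%:Z)%Z|.
have resE s : (res s)%:Z = (s %% N.+1%:Z)%Z.
  rewrite /res inordK ?gez0_abs ?modz_ge0//.
  by rewrite -ltz_nat gez0_abs ?modz_ge0// ltz_pmod.
pose Phi (c : {ffun 'I_d -> 'I_N.+1}) : {ffun 'I_d -> 'I_N.+1} :=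
  [ffun i => if i == i0 then res (grid_dot c) else c i].
have Phi_inj : injective Phi.
  move=> c c' /ffunP E.
  have Ei i : i != i0 -> c i = c' i.
    by move=> /negbTE ii0; have := E i; rewrite !ffunE ii0.
  have /(congr1 (fun i : 'I__ => (i : nat)%:Z)) :
      res (grid_dot c) = res (grid_dot c').
    by have := E i0; rewrite !ffunE eqxx.
  rewrite !resE => /eqP; rewrite eqz_mod_dvd.
  have -> : grid_dot c - grid_dot c' = h 0 i0 * ((c i0)%:Z - (c' i0)%:Z).
    rewrite /grid_dot -sumrB (bigD1 i0)//= big1 ?addr0 ?mulrBr//.
    by move=> i /Ei ->; rewrite subrr.
  rewrite Gauss_dvdzr 1?coprimez_sym// => /dvdzP[q Eq].
  apply/ffunP => i; have [->|/Ei//] := eqVneq i i0; apply/val_inj => /=.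
  have := ltn_ord (c i0); have := ltn_ord (c' i0).
  have : q = 0 \/ q >= 1 \/ q <= -1 by lia.
  by move: Eq; case: q => -[|q]; nia.
pose A : {set 'I_N.+1} :=
  [set r : 'I_N.+1 | (r <= norm1)%N || (N.+1 <= r + norm1)%N].
have cardA : (#|A| <= (2 * norm1).+1)%N.
  pose psi (j : 'I_(2 * norm1).+1) : 'I_N.+1 :=
    if (j <= norm1)%N then inord j else inord (N.+1 - (j - norm1)).
  apply: (@leq_trans #|[set psi j | j in [set: 'I_(2 * norm1).+1]]|);
      last first.
    by rewrite (leq_trans (leq_imset_card _ _))// cardsT card_ord.
  apply/subset_leq_card/fintype.subsetP => r; rewrite inE => /orP rA.
  case: (leqP r norm1) => [rn|nr].
    apply/imsetP; exists (inord r) => //; rewrite /psi inordK ?rn ?inord_val//.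
    lia.
  have rN := ltn_ord r.
  have {}rA : (N.+1 <= r + norm1)%N by case: rA => //; lia.
  apply/imsetP; exists (inord (N.+1 - r + norm1)%N) => //.
  rewrite /psi inordK; last by lia.
  case: ifP => [|_]; first by lia.
  by apply/val_inj => /=; rewrite inordK; lia.
rewrite -(card_imset _ Phi_inj).
apply: (@leq_trans #|[set e : {ffun 'I_d -> 'I_N.+1} | e i0 \in A]|).
  apply/subset_leq_card/fintype.subsetP => _ /imsetP[c + ->].
  rewrite !inE ffunE eqxx /near_multiple -resE.
  lia.
by rewrite card_coord leq_mul2r cardA orbT.
Qed.

Lemma slab_index (N : nat) (s : int) : (0 < N)%N -> ~~ near_multiple N s ->
  N%:Z * (s %/ N%:Z)%Z + norm1%:Z < s /\
  s + norm1%:Z < N%:Z * ((s %/ N%:Z)%Z + 1).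
Proof.
move=> N_gt0; rewrite /near_multiple negb_or -!ltNge => /andP[h1 h2].
have := divz_eq s N%:Z.
move: (s %% N%:Z)%Z (s %/ N%:Z)%Z h1 h2 => r k h1 h2 ->.
by rewrite [k * _]mulrC mulrDr mulr1; move: (_ * k) => Nk; split; lia.
Qed.

End GridResidues.

(** Translates a bound on twice the centered sum [2 * S - (N - 1) * A] into a
    window for [S] whose ends are multiples of [N]. The three extra units
    absorb the rounding of [A / 2] and the presence of [N - 1] instead of
    [N]. *)
Lemma window_arith (N r A S a b : int) : `|A| <= N -> 0 <= b -> b < 2 ->
  A = a * 2 + b -> `|2 * S - (N - 1) * A| <= 2 * N * r ->
  N * (a - 1 - r) <= S <= N * (a - 1 - r + (2 * r + 3)).
Proof.
move=> AN b0 b2 AE.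
have NA : N * A = 2 * (N * a) + N * b by rewrite AE; ring.
have Nb : 0 <= N * b /\ N * b <= N by split; nia.
rewrite mulrBl mul1r NA -mulrA.
have -> : N * (a - 1 - r + (2 * r + 3)) = N * a + 2 * N + N * r by ring.
have -> : N * (a - 1 - r) = N * a - N - N * r by ring.
move: (N * a) (N * b) (N * r) Nb => Na Nb Nr [Nb0 NbN]; clear - AN Nb0 NbN.
lia.
Qed.

Section GridVariance.
Variables (d N : nat) (h : 'rV[int]_d).
Implicit Types (c : {ffun 'I_d -> 'I_N}).

(** Twice the deviation of the i-th coordinate from its mean (N - 1) / 2, to
    stay within the integers. *)
Let deviation c (i : 'I_d) : int := 2 * (c i)%:Z - (N%:Z - 1).

Let flip (i : 'I_d) c : {ffun 'I_d -> 'I_N} :=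
  [ffun j => if j == i then rev_ord (c j) else c j].

Let flipK i : involutive (flip i).
Proof.
move=> c; apply/ffunP => j; rewrite !ffunE.
by case: eqP => // _; exact: rev_ordK.
Qed.

Let deviation_flip i c j : deviation (flip i c) j =
  if j == i then - deviation c j else deviation c j.
Proof.
rewrite /deviation ffunE; case: eqP => // _ /=.
by have := ltn_ord (c j); move: (nat_of_ord (c j)) => a; lia.
Qed.

Let uncorrelated i j : i != j -> \sum_c deviation c i * deviation c j = 0.
Proof.
move=> /negbTE ij; set s := \sum_c _.
suff : s = - s by lia.
rewrite {1}/s (reindex_inj (inv_inj (flipK i))) -sumrN.
by apply: eq_bigr => c _; rewrite !deviation_flip eqxx eq_sym ij mulNr.
Qed.

(** Chebyshev's second moment: reflecting one coordinate shows that the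
    deviations of distinct coordinates are uncorrelated, so only the squares
    contribute. *)
Lemma grid_second_moment :
  \sum_c (\sum_i h 0 i * deviation c i) ^+ 2 <=
    (N ^ d)%:Z * N%:Z ^+ 2 * \sum_i h 0 i ^+ 2.
Proof.
have -> : \sum_c (\sum_i h 0 i * deviation c i) ^+ 2 =
    \sum_i h 0 i ^+ 2 * \sum_c deviation c i ^+ 2.
  rewrite (eq_bigr (fun c => \sum_i \sum_j
      (h 0 i * h 0 j) * (deviation c i * deviation c j))); last first.
    move=> c _; rewrite expr2 mulr_suml; apply: eq_bigr => i _.
    by rewrite mulr_sumr; apply: eq_bigr => j _; rewrite mulrACA.
  rewrite exchange_big/=; apply: eq_bigr => i _.
  rewrite exchange_big (bigD1 i)//= [X in _ + X]big1 ?addr0 => [|j ji].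
    by rewrite -mulr_sumr.
  by rewrite -mulr_sumr uncorrelated ?mulr0// eq_sym.
rewrite mulr_sumr; apply: ler_sum => i _; rewrite mulrC ler_wpM2r ?sqr_ge0//.
have -> : (N ^ d)%:Z * N%:Z ^+ 2 =
    \sum_(c : {ffun 'I_d -> 'I_N}) N%:Z ^+ 2.
  by rewrite sumr_const card_ffun !card_ord -[RHS]mulr_natl natz.
apply: ler_sum => c _; rewrite /deviation.
by have := ltn_ord (c i); move: (nat_of_ord (c i)) => a; clear; nia.
Qed.

(** Chebyshev's inequality: the values outside the window are at least two
    standard deviations away from the mean, and make up at most a quarter. *)
Lemma card_grid_window (r : nat) :
  (0 < N)%N -> (norm1 h <= N)%N -> (0 < r)%N ->
  \sum_i h 0 i ^+ 2 <= r%:Z ^+ 2 ->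
  (3 * N ^ d <= 4 * #|[set c : {ffun 'I_d -> 'I_N} |
     (N%:Z * (((\sum_i h 0%R i) %/ 2)%Z - 1 - r%:Z) <= grid_dot h c <=
      N%:Z * (((\sum_i h 0%R i) %/ 2)%Z - 1 - r%:Z + (2 * r + 3)%N%:Z))%R]|)%N.
Proof.
move=> N0 hN r0 hr.
set A := \sum_i h 0 i; set k0 : int := (A %/ 2)%Z - 1 - r%:Z.
set W := [set c | _].
pose T c := \sum_i h 0 i * deviation c i.
have TE c : T c = 2 * grid_dot h c - (N%:Z - 1) * A.
  rewrite /T /grid_dot /A !mulr_sumr -sumrB.
  by apply: eq_bigr => i _; rewrite /deviation; ring.
pose B := [set c | (2 * N%:Z * r%:Z) ^+ 2 < T c ^+ 2].
have AN : `|A| <= N%:Z.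
  rewrite (le_trans (ler_norm_sum _ _ _))//.
  apply: le_trans (_ : (norm1 h)%:Z <= _) => //.
  by rewrite /norm1 (big_morph Posz PoszD (erefl _)); apply: ler_sum.
have WB : ~: B \subset W.
  apply/fintype.subsetP => c; rewrite !inE -leNgt.
  move=> Tc; have : `|T c| <= 2 * N%:Z * r%:Z.
    by rewrite -(@ler_pXn2r _ 2) ?nnegrE ?real_normK ?num_real ?mulr_ge0.
  rewrite TE /k0; have := divz_eq A 2; have := modz_ge0 A (isT : 2 != 0 :> int).
  have := ltz_pmod A (isT : 0 < 2 :> int).
  rewrite PoszD PoszM => b2 b0 AE TN.
  exact: window_arith AN b0 b2 AE TN.
have cardB : (4 * #|B| <= N ^ d)%N.
  have le1 : \sum_(c in B) (2 * N%:Z * r%:Z) ^+ 2 <= \sum_c T c ^+ 2.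
    rewrite [leRHS](bigID [in B])/= -[leLHS]addr0 lerD//.
      by apply: ler_sum => c; rewrite inE => /ltW.
    by apply: sumr_ge0 => c _; exact: sqr_ge0.
  have Nr0 : 0 < N%:Z ^+ 2 * r%:Z ^+ 2 by rewrite mulr_gt0 ?exprn_gt0.
  rewrite -lez_nat -(ler_pM2r Nr0).
  have := le_trans le1 grid_second_moment.
  rewrite sumr_const -mulr_natl natz => le2.
  have := le_trans le2 (ler_wpM2l _ hr).
  rewrite mulr_ge0 ?sqr_ge0// => /(_ isT).
  rewrite PoszM; congr (_ <= _); ring.
have := subset_leq_card WB; have := cardsC B.
rewrite card_ffun !card_ord; lia.
Qed.

End GridVariance.

(** * Large sets of integer vectors with small diameter *)

Lemma exists_floor_root (k m : nat) : (0 < k)%N ->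
  exists2 s, (s ^ k <= m)%N & (m < s.+1 ^ k)%N.
Proof.
move=> k0; have ex : exists s, (s ^ k <= m)%N by exists 0%N; rewrite exp0n.
have bd s : (s ^ k <= m)%N -> (s <= m)%N.
  case: s => // s; apply: leq_trans; rewrite -[leqLHS]expn1.
  by rewrite leq_pexp2l.
case: (ex_maxnP ex bd) => s sk smax; exists s => //.
by rewrite ltnNge; apply/negP => /smax; rewrite ltnn.
Qed.

Definition centered_ints (l r : nat) : seq int :=
  map Posz (iota 0 l.+1) ++ map Negz (iota 0 r).

(** The integer points, as sequences of length [d.+1], of a cross-polytope of
    l1-diameter [s]. Its center is the origin for even [s], and for odd [s]
    the point with last coordinate 1/2 and other coordinates 0. Odd diameters
    matter, as rounding [s] down to an even number would weaken the bound on
    the shortest vector. *)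
Fixpoint l1_balls (d s : nat) : seq (seq int) :=
  if d is d'.+1 then
    [seq a :: z | a <- centered_ints s./2 s./2,
                  z <- l1_balls d' (s - `|a|.*2)]
  else [seq [:: a] | a <- centered_ints (uphalf s) s./2].

Lemma l1_balls0 s :
  l1_balls 0 s = [seq [:: a] | a <- centered_ints (uphalf s) s./2].
Proof. by []. Qed.

Lemma l1_ballsS d s : l1_balls d.+1 s =
  [seq a :: z | a <- centered_ints s./2 s./2, z <- l1_balls d (s - `|a|.*2)].
Proof. by []. Qed.

Lemma mem_centered_ints l r a :
  (a \in centered_ints l r) = (- r%:Z <= a <= l%:Z).
Proof.
rewrite mem_cat; apply/orP/idP => [[/mapP[j]|/mapP[j]]|].
- by rewrite mem_iota => jl ->; lia.
- by rewrite mem_iota => jl ->; lia.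
case: a => j jlr; [left|right]; apply/mapP; exists j => //;
  rewrite mem_iota; lia.
Qed.

Lemma uniq_centered_ints l r : uniq (centered_ints l r).
Proof.
rewrite cat_uniq !map_inj_uniq ?iota_uniq/= ?andbT; try by move=> x y [].
by apply/hasPn => _ /mapP[j _ ->]; apply/mapP => -[].
Qed.

Lemma size_l1_balls_mem d s z : z \in l1_balls d s -> size z = d.+1.
Proof.
elim: d s z => [|d IH] s z; first by rewrite l1_balls0 => /mapP[a _ ->].
by rewrite l1_ballsS => /allpairsPdep[a [y [_ /IH yd ->]]] /=; rewrite yd.
Qed.

Lemma uniq_l1_balls d s : uniq (l1_balls d s).
Proof.
elim: d s => [|d IH] s.
  by rewrite l1_balls0 map_inj_uniq ?uniq_centered_ints// => a b [].
rewrite l1_ballsS; apply: allpairs_uniq_dep => //.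
  exact: uniq_centered_ints.
by move=> [a y] [b z] /= _ _ [-> ->].
Qed.

(** Two sizes [s] and [t] are needed for the induction, since slices at
    different heights have different sizes; equal parity means equal centers. *)
Lemma l1_balls_dist d s t (z w : seq int) : odd s = odd t ->
  z \in l1_balls d s -> w \in l1_balls d t ->
  ((\sum_(i < d.+1) `|(z`_i - w`_i)%R|).*2 <= s + t)%N.
Proof.
elim: d s t z w => [|d IH] s t z w st.
  rewrite !l1_balls0 => /mapP[a + ->] /mapP[b + ->].
  rewrite big_ord1 !mem_centered_ints/=.
  lia.
rewrite !l1_ballsS.
move=> /allpairsPdep[a [y [+ yd ->]]] /allpairsPdep[b [x [+ xd ->]]].
rewrite !mem_centered_ints big_ord_recl/=.
rewrite (eq_bigr (fun i : 'I_d.+1 => `|(y`_i - x`_i)%R|%N))// => ha hb.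
have := IH _ _ _ _ _ yd xd; rewrite !oddB; last 2 first.
- lia.
- lia.
rewrite !odd_double st => /(_ erefl).
move: (\sum_(i < _) _)%N => S; clear - ha hb; lia.
Qed.

(** Apart from its middle slice, the large ball consists of slices which,
    shifted by one towards the middle, form two copies of the nonnegative
    heights of the small ball, that is, the small ball with its middle slice
    doubled. *)
Lemma size_l1_ballsS d s : size (l1_balls d.+1 s.+2) =
  (size (l1_balls d.+1 s) + size (l1_balls d s.+2) + size (l1_balls d s))%N.
Proof.
pose G k m := (\sum_(0 <= j < k) size (l1_balls d (m - j.*2)))%N.
have sizeE m : size (l1_balls d.+1 m) =
    (G m./2.+1 m + \sum_(0 <= j < m./2) size (l1_balls d (m - j.+1.*2)))%N.
  rewrite l1_ballsS size_allpairs_dep sumnE big_map /centered_ints.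
  by rewrite big_cat !big_map /G /index_iota !subn0.
have shift m : (\sum_(0 <= j < m./2.+1) size (l1_balls d (m.+2 - j.+1.*2)) =
    G m./2.+1 m)%N.
  by apply: eq_bigr => j _; congr (size (l1_balls d _)); lia.
have first k m : G k.+1 m =
    (size (l1_balls d m) + \sum_(0 <= j < k) size (l1_balls d (m - j.+1.*2)))%N.
  by rewrite /G big_nat_recl// double0 subn0.
rewrite !sizeE [_.+2./2]/= shift (first _ s.+2) shift {1}(first _ s).
lia.
Qed.

(** The trapezoidal rule overestimates the integral over [y, y + 2] of the
    convex function x^d. *)
Lemma trapezoid_pow (d y : nat) :
  (y.+2 ^ d.+1 <= y ^ d.+1 + d.+1 * (y.+2 ^ d + y ^ d))%N.
Proof.
elim: d => [|d IH]; first by rewrite !expn1 !expn0; lia.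
have le_pow : (y ^ d <= y.+2 ^ d)%N.
  by case: d {IH} => // e; rewrite leq_exp2r// !leqW.
move: IH; rewrite !(expnS _ d.+1) !(expnS _ d).
move: (y ^ d)%N (y.+2 ^ d)%N le_pow => Y X YX IH.
have := leq_mul (leqnn y.+1) IH.
have : (d.+1 * (y.+1 * (X + Y)) <= d.+1 * (y.+2 * X + y * Y))%N.
  by rewrite leq_mul2l/=; nia.
nia.
Qed.

(** The number of points dominates (s + 1)^(d+1) / (d+1)!, the volume of the
    cross-polytope of diameter [s + 1]. By the trapezoidal rule this volume
    grows in [s] at most as fast as the recursion for the number of points. *)
Lemma size_l1_balls d s : (s.+1 ^ d.+1 <= d.+1`! * size (l1_balls d s))%N.
Proof.
elim: d s => [|d IHd] s.
  by rewrite l1_balls0 size_map size_cat !size_map !size_iota expn1 mul1n; lia.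
suff H k : (k.+1 ^ d.+2 <= d.+2`! * size (l1_balls d.+1 k))%N /\
    (k.+2 ^ d.+2 <= d.+2`! * size (l1_balls d.+1 k.+1))%N by case: (H s).
elim: k => [|k [IH1 IH2]]; split => //.
- have := IHd 0%N.
  by rewrite l1_ballsS /= cats0 size_map !exp1n !muln_gt0 !fact_gt0.
- have := IHd 1%N; rewrite l1_ballsS /= cats0 size_map.
  by rewrite (factS d.+1) (expnS _ d.+1) -mulnA => h; apply: leq_mul.
- rewrite size_l1_ballsS (leq_trans (trapezoid_pow _ _))// factS.
  have := IHd k; have := IHd k.+2; move: IH1; rewrite factS.
  nia.
Qed.

Local Open Scope classical_set_scope.

(** * Lower bounds for the outer measure *)

Section ProductIntegration.
Variables (R : realType) (d : nat) (I : finType) (C : {set I}).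
Variables (f : I -> 'I_d -> R -> R) (g : nat -> 'I_d -> R -> R).
Variables (a : I -> 'I_d -> R) (b : nat -> 'I_d -> R).
Hypothesis f_ge0 : forall c i t, 0 <= f c i t.
Hypothesis g_ge0 : forall k i t, 0 <= g k i t.
Hypothesis a_ge0 : forall c i, 0 <= a c i.
Hypothesis b_ge0 : forall k i, 0 <= b k i.
Hypothesis f_meas : forall c i, measurable_fun setT (f c i).
Hypothesis g_meas : forall k i, measurable_fun setT (g k i).
Let mu := @lebesgue_measure R.
Implicit Types (u x : 'I_d -> R) (v : 'I_d -> R -> R).
Hypothesis f_int : forall c i, (\int[mu]_t (f c i t)%:E = (a c i)%:E)%E.
Hypothesis g_int : forall k i, (\int[mu]_t (g k i t)%:E = (b k i)%:E)%E.

(* Coordinates below [j] are integrated out, the other ones still free. *)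
Let mixed (u : 'I_d -> R) (v : 'I_d -> R -> R) (j : nat) (x : 'I_d -> R) : R :=
  \prod_(i < d) (if (i < j)%N then u i else v i (x i)).

Let mixed_ge0 u v j x : (forall i, 0 <= u i) -> (forall i t, 0 <= v i t) ->
  0 <= mixed u v j x.
Proof. by move=> u0 v0; apply: prodr_ge0 => i _; case: ifP. Qed.

Let subst (x : 'I_d -> R) (i0 : 'I_d) (t : R) : 'I_d -> R :=
  fun i => if i == i0 then t else x i.

Let rest u v (i0 : 'I_d) x : R :=
  \prod_(i < d | i != i0) (if (i < i0)%N then u i else v i (x i)).

Let mixed_subst u v (i0 : 'I_d) x t :
  mixed u v i0 (subst x i0 t) = rest u v i0 x * v i0 t.
Proof.
rewrite /mixed (bigD1 i0)//= ltnn /subst eqxx mulrC; congr (_ * _).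
by apply: eq_bigr => i /negbTE ->.
Qed.

Let mixedS u v (i0 : 'I_d) x :
  mixed u v i0.+1 x = rest u v i0 x * u i0.
Proof.
rewrite /mixed (bigD1 i0)//= ltnSn mulrC; congr (_ * _).
apply: eq_bigr => i; rewrite -val_eqE /= ltnS leq_eqVlt => /negbTE ->.
by [].
Qed.

Let mixed_int u v (i0 : 'I_d) x : (forall i, 0 <= u i) ->
  (forall i t, 0 <= v i t) -> measurable_fun setT (v i0) ->
  (\int[mu]_t (v i0 t)%:E = (u i0)%:E)%E ->
  (\int[mu]_t (mixed u v i0 (subst x i0 t))%:E = (mixed u v i0.+1 x)%:E)%E.
Proof.
move=> u0 v0 mv iv.
under eq_integral do rewrite mixed_subst EFinM.
rewrite ge0_integralZl_EFin//=; last 3 first.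
- by move=> t _; rewrite lee_fin.
- exact/measurable_EFinP.
- by apply: prodr_ge0 => i _; case: ifP.
by rewrite iv mixedS EFinM.
Qed.

Let mixed_meas u v (i0 : 'I_d) x : measurable_fun setT (v i0) ->
  measurable_fun setT (fun t => (mixed u v i0 (subst x i0 t))%:E).
Proof.
move=> mv; apply/measurable_EFinP.
under eq_fun do rewrite mixed_subst.
exact: measurable_funM.
Qed.

(** Fubini's theorem for an inequality between sums of product functions: it
    can be integrated in one variable at a time, with one-dimensional
    integrals only. Applied to indicators of boxes it compares volumes. *)
Lemma le_sum_prod_integral :
  (forall x, (\sum_(c in C) (\prod_i f c i (x i))%:E <=
     \sum_(0 <= k <oo) (\prod_i g k i (x i))%:E)%E) ->
  ((\sum_(c in C) \prod_i a c i)%:E <=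
     \sum_(0 <= k <oo) (\prod_i b k i)%:E)%E.
Proof.
move=> cover.
suff H j : (j <= d)%N -> forall x,
    (\sum_(c in C) (mixed (a c) (f c) j x)%:E <=
     \sum_(0 <= k <oo) (mixed (b k) (g k) j x)%:E)%E.
  have mixedE u v x : mixed u v d x = \prod_i u i.
    by apply: eq_bigr => i _; rewrite ltn_ord.
  have := H d (leqnn d) (fun=> 0); rewrite sumEFin.
  under eq_bigr do rewrite mixedE.
  by under eq_eseriesr do rewrite mixedE.
elim: j => [_ x|j IH jd x]; first exact: cover.
pose i0 := Ordinal jd.
have fm c := mixed_int x (a_ge0 c) (f_ge0 c) (f_meas c i0) (f_int c i0).
have gm k := mixed_int x (b_ge0 k) (g_ge0 k) (g_meas k i0) (g_int k i0).
under eq_bigr do rewrite -(fm _).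
under eq_eseriesr do rewrite -(gm _).
rewrite -big_filter -ge0_integral_sum//=; last 2 first.
- by move=> c; exact: (mixed_meas (a c) x (f_meas c i0)).
- by move=> c t _; rewrite lee_fin mixed_ge0.
rewrite -integral_nneseries//=; last 2 first.
- by move=> k; exact: (mixed_meas (b k) x (g_meas k i0)).
- by move=> k t _; rewrite lee_fin mixed_ge0.
apply: ge0_le_integral => //=.
- by move=> t _; apply: sume_ge0 => c _; rewrite lee_fin mixed_ge0.
- by apply: emeasurable_sum => c; exact: (mixed_meas (a c) x (f_meas c i0)).
- have ge0 k t : setT t -> true ->
      (0 <= (mixed (b k) (g k) i0 (subst x i0 t))%:E)%E.
    by move=> _ _; rewrite lee_fin mixed_ge0.
  apply: (ge0_emeasurable_sum (P := xpredT) ge0) => k _.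
  exact: (mixed_meas (b k) x (g_meas k i0)).
by move=> t _; rewrite big_filter; apply: IH; exact: ltnW.
Qed.

End ProductIntegration.

Section GridCells.
Variables (R : realType) (d N : nat).
Hypothesis N_gt0 : (0 < N)%N.
Implicit Types (c : {ffun 'I_d -> 'I_N}) (C : {set {ffun 'I_d -> 'I_N}}).

Definition open_cell c : set 'rV[R]_d :=
  [set x | forall i, (c i)%:R < N%:R * x 0 i < (c i).+1%:R].

Let side c (i : 'I_d) : set R := `](c i)%:R / N%:R, (c i).+1%:R / N%:R[%classic.

Let N0 : 0 < N%:R :> R. Proof. by rewrite ltr0n. Qed.

Let in_side c i t : (t \in side c i) = ((c i)%:R < N%:R * t < (c i).+1%:R).
Proof. by rewrite mem_setE in_itv/= ltr_pdivrMr// ltr_pdivlMr// mulrC. Qed.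

Let side_inj c i (c' : {ffun 'I_d -> 'I_N}) t :
  t \in side c i -> t \in side c' i -> c i = c' i.
Proof.
rewrite !in_side => /andP[l1 r1] /andP[l2 r2]; apply/val_inj => /=.
have := lt_trans l1 r2; have := lt_trans l2 r1; rewrite !ltr_nat !ltnS.
by move=> h1 h2; apply/eqP; rewrite eqn_leq h1 h2.
Qed.

(** The cells are disjoint, so the sum of their indicators is at most 1 on
    [A] and 0 elsewhere; any cover of [A] by boxes dominates it, and
    integrating gives the bound for the cover. *)
Lemma vol_ge_cells C (A : set 'rV[R]_d) :
  (forall c, c \in C -> open_cell c `<=` A) ->
  ((#|C|%:R / N%:R ^+ d)%:E <= vol A)%E.
Proof.
move=> CA; apply: le_ereal_inf_tmp => _ [ab /= Aab <-].
pose bx k i : set R := `](ab k).1 0 i, (ab k).2 0 i]%classic.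
have -> : #|C|%:R / N%:R ^+ d = \sum_(c in C) \prod_(i < d) (N%:R^-1 : R).
  by rewrite sumr_const prodr_const card_ord -[RHS]mulr_natl exprVn.
apply: (@le_sum_prod_integral R d _ C (fun c i => \1_(side c i))
  (fun k i => \1_(bx k i)) (fun _ _ => N%:R^-1)
  (fun k i => Num.max 0 ((ab k).2 0 i - (ab k).1 0 i))) => //.

- by move=> *; rewrite le_max lexx.
- by move=> c i; apply: measurable_indic; exact: measurable_itv.
- by move=> c i; apply: measurable_indic; exact: measurable_itv.
- move=> c i; rewrite integral_indic//=; last exact: measurable_itv.
  rewrite setIT lebesgue_measure_itv/= lte_fin ltr_pM2r ?invr_gt0//.
  by rewrite ltr_nat ltnSn -EFinB -mulrBl -natrB// subSnn mul1r.
- move=> k i; rewrite integral_indic//=; last exact: measurable_itv.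
  rewrite setIT lebesgue_measure_itv/= lte_fin; case: ltrP => h.
    by rewrite -EFinB max_r// subr_ge0 ltW.
  by rewrite max_l// subr_le0.
move=> x.
have cell1 c : \prod_(i < d) (\1_(side c i) (x i) : R) =
    [forall i, x i \in side c i]%:R.
  case: (boolP [forall i, _]) => [/forallP h|].
    by rewrite big1// => i _; rewrite indicE h.
  rewrite negb_forall => /existsP[i hi].
  by rewrite (bigD1 i)//= indicE (negbTE hi) mul0r.
under eq_bigr do rewrite cell1.
have ge0 k : (0 <= (\prod_(i < d) (\1_(bx k i) (x i) : R))%:E)%E.
  by rewrite lee_fin prodr_ge0.
case: (pickP [pred c in C | [forall i, x i \in side c i]]) => [c|noc].
  move=> /andP[/= cC /forallP xc].
  rewrite (bigD1 c)//= [X in (_ + X)%E]big1 ?adde0; last first.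
    move=> c' /andP[_ c'c]; case: (boolP [forall i, _]) => // /forallP xc'.
    case/negP: c'c; apply/eqP/ffunP => i.
    exact: side_inj (xc' i) (xc i).
  have -> : [forall i, x i \in side c i] by apply/forallP.
  have /Aab[k _ xk] : A (\row_i x i).
    by apply: (CA c) => // i; have := xc i; rewrite mxE in_side.
  apply: (@le_trans _ _ (\sum_(0 <= k' < k.+1)
     (\prod_(i < d) (\1_(bx k' i) (x i) : R))%:E)%E); last first.
    by apply: nneseries_lim_ge => *; exact: ge0.
  rewrite big_nat_recr//=.
  have -> : \prod_(i < d) (\1_(bx k i) (x i) : R) = 1.
    apply: big1 => i _; rewrite indicE mem_set//=.
    by have := xk i; rewrite mxE /bx/= in_itv.
  by rewrite leeDr// sume_ge0.
rewrite big1; first by apply: nneseries_ge0 => *; exact: ge0.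
by move=> c cC; have /= := noc c; rewrite cC/= => ->.
Qed.

End GridCells.

(** * Slabs between consecutive dual hyperplanes *)

Section Slabs.
Variables (R : realType) (d : nat) (h : 'rV[int]_d).

Definition real_vec : 'rV[R]_d := map_mx intr h.

Definition slab (k : int) : set 'rV[R]_d :=
  [set x | unit_cube x /\ k%:~R < dot real_vec x < (k + 1)%:~R].

Lemma convex_slab k : convex_in_cube (slab k).
Proof.
split=> [|x []//]; apply/convex_setW => x y; rewrite !inE.
move=> -[xC /andP[kx xk]] [yC /andP[ky yk]] t t0 t1.
rewrite inE; set z := conv _ _ _.
have zE i : z 0 i = t%:num * x 0 i + (1 - t%:num) * y 0 i by rewrite !mxE.
have t1' : 0 < 1 - t%:num by rewrite subr_gt0.
split=> [i|].
  have /andP[x0 x1] := xC i; have /andP[y0 y1] := yC i; rewrite zE.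
  by apply/andP; split; nra.
have -> : dot real_vec z =
    t%:num * dot real_vec x + (1 - t%:num) * dot real_vec y.
  rewrite /dot !mulr_sumr -big_split/=; apply: eq_bigr => i _.
  by rewrite zE; ring.
by apply/andP; split; nra.
Qed.

(** Within a cell, [N] times the inner product with [h] differs from its
    value at the corner by at most the l1-norm of [h]. *)
Lemma cell_subset_slab (N : nat) (c : {ffun 'I_d -> 'I_N}) (k : int) :
  (0 < N)%N -> N%:Z * k + (norm1 h)%:Z < grid_dot h c ->
  grid_dot h c + (norm1 h)%:Z < N%:Z * (k + 1) ->
  @open_cell R d N c `<=` slab k.
Proof.
move=> N_gt0 lo hi x xc.
have N0 : 0 < N%:R :> R by rewrite ltr0n.
split=> [i|].
  have /andP[l r] := xc i; apply/andP; split.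
    by rewrite -(pmulr_rge0 _ N0) (le_trans _ (ltW l)).
  by rewrite -(ltr_pM2l N0) mulr1 (lt_le_trans r)// ler_nat.
have bound : `|N%:R * dot real_vec x - (grid_dot h c)%:~R| <= (norm1 h)%:R.
  rewrite /dot /grid_dot /norm1 mulr_sumr rmorph_sum/= -sumrB natr_sum.
  apply: le_trans (ler_norm_sum _ _ _) _; apply: ler_sum => i _.
  rewrite mxE intrM -pmulrn mulrCA -mulrBr normrM.
  rewrite -[leRHS]mulr1 natr_absz intr_norm ler_wpM2l//.
  have /andP[l r] := xc i; rewrite ler_norml -natr1 in r *.
  by apply/andP; split; lra.
move: lo hi; rewrite -!(ltr_int R) !(rmorphD, rmorphM)/= -!pmulrn => lo hi.
move: bound; rewrite ler_norml => /andP[bl bh].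
by apply/andP; split; rewrite -(ltr_pM2l N0) ?rmorphD/=; lra.
Qed.

(** Here [D] is any common bound for the volumes of the slabs. For each grid,
    the cells of the window that are not cut by a hyperplane are distributed
    over [m] slabs; the cut ones have a proportion of order 1/N, which
    vanishes in the limit. *)
Lemma le_slab_average (D : \bar R) (p : R) (k0 : int) (m : nat) :
  h != 0 -> (0 < m)%N ->
  (forall N, (0 < N)%N -> (norm1 h <= N)%N -> p * N%:R ^+ d <=
     #|[set c : {ffun 'I_d -> 'I_N} |
         N%:Z * k0 <= grid_dot h c <= N%:Z * (k0 + m%:Z)]%SET|%:R) ->
  (forall k, (vol (slab k) <= D)%E) ->
  ((p / m%:R)%:E <= D)%E.
Proof.
move=> h0 m0 window volD.
have [i0 hi0] : exists i0, h 0 i0 != 0.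
  by apply/rV0Pn.
have d0 : (0 < d)%N by apply: leq_ltn_trans (ltn_ord i0).
pose H := norm1 h.
have cellsD N (C : {set {ffun 'I_d -> 'I_N}}) k : (0 < N)%N ->
    (forall c, c \in C -> N%:Z * k + H%:Z < grid_dot h c /\
       grid_dot h c + H%:Z < N%:Z * (k + 1)) ->
    ((#|C|%:R / N%:R ^+ d)%:E <= D)%E.
  move=> N0 Ck; apply: le_trans (volD k).
  apply: vol_ge_cells => // c /Ck[lo hi].
  exact: cell_subset_slab.
case: D volD cellsD => [r| |] volD cellsD; last 2 first.
- by rewrite leey.
- have := cellsD 1%N finset.set0 0 isT.
  by rewrite leeNy_eq => contra; apply: contra => c; rewrite finset.in_set0.
have main N : (0 < N)%N -> (H <= N)%N -> coprimez (h 0 i0) N%:Z ->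
    p - (2 * H).+1%:R / N%:R <= r * m%:R.
  move=> N_gt0 HN cop.
  have N0 : 0 < N%:R :> R by rewrite ltr0n.
  have Nd0 : 0 < N%:R ^+ d :> R by rewrite exprn_gt0.
  pose G (j : 'I_m) := [set c : {ffun 'I_d -> 'I_N} |
    (N%:Z * (k0 + j%:Z) + H%:Z < grid_dot h c) &&
    (grid_dot h c + H%:Z < N%:Z * (k0 + j%:Z + 1))]%SET.
  have cardG j : #|G j|%:R <= r * N%:R ^+ d.
    rewrite -ler_pdivrMr// -lee_fin; apply: (cellsD _ _ (k0 + j%:Z)) => // c.
    by rewrite inE => /andP.
  pose W := [set c : {ffun 'I_d -> 'I_N} |
    N%:Z * k0 <= grid_dot h c <= N%:Z * (k0 + m%:Z)]%SET.
  pose B :=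
    [set c : {ffun 'I_d -> 'I_N} | near_multiple h N (grid_dot h c)]%SET.
  have WBG : W \subset (B :|: \bigcup_j G j)%SET.
    apply/fintype.subsetP => c; rewrite !inE => /andP[w1 w2].
    have [//|nb] := boolP (near_multiple h N (grid_dot h c)).
    have [g1 g2] := slab_index N_gt0 nb.
    move: (_ %/ _)%Z g1 g2 => k g1 g2.
    have N0z : 0 < N%:Z by lia.
    have kk0 : k0 < k + 1 by rewrite -(ltr_pM2l N0z); lia.
    have kkm : k < k0 + m%:Z by rewrite -(ltr_pM2l N0z); lia.
    have jm : (`|k - k0| < m)%N by lia.
    apply/bigcupP; exists (Ordinal jm) => //; rewrite inE/=.
    have -> : k0 + `|k - k0|%N%:Z = k by lia.
    by rewrite g1 g2.
  have := window N N_gt0 HN; rewrite -/W => le1.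
  have le2 : #|W|%:R <= #|B|%:R + \sum_j #|G j|%:R :> R.
    rewrite -natr_sum -natrD ler_nat (leq_trans (subset_leq_card WBG))//.
    rewrite (leq_trans (leq_card_setU _ _))// leq_add2l.
    elim/big_ind2: _ => [|A a A' a' lA lA'|//]; first by rewrite cards0.
    by rewrite (leq_trans (leq_card_setU _ _))// leq_add.
  have le3 : \sum_j #|G j|%:R <= r * m%:R * N%:R ^+ d.
    rewrite mulrAC mulr_natr -[X in _ *+ X]card_ord -sumr_const.
    by apply: ler_sum => j _; exact: cardG.
  have le4 : #|B|%:R <= (2 * H).+1%:R / N%:R * N%:R ^+ d :> R.
    have := card_near_multiple N_gt0 cop; rewrite -(ler_nat R) natrM natrX.
    move=> /le_trans; apply; rewrite -[in leRHS](prednK d0) exprS mulrA divfK//.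
    by rewrite gt_eqF.
  rewrite -(ler_pM2r Nd0) mulrBl; lra.
rewrite lee_fin ler_pdivrMr ?ltr0n//.
rewrite leNgt; apply/negP => lt.
pose e := p - r * m%:R.
have e0 : 0 < e by rewrite subr_gt0.
(* Any N = 1 + |h_i0| q is coprime to h_i0. *)
pose q := ((Num.truncn ((2 * H).+1%:R / e)).+1 + H)%N.
have qe : (2 * H).+1%:R / e < q%:R by rewrite natrD ltr_wpDr ?truncnS_gt.
pose N := (1 + `|h 0%R i0| * q)%N.
have NP : (0 < N)%N by [].
have cop : coprimez (h 0 i0) N%:Z.
  by rewrite /coprimez /gcdz /= /N addnC mulnC gcdnMDl gcdn1.
have qN : (q <= N)%N.
  by rewrite /N (leq_trans _ (leq_addl _ _))// leq_pmull// lt0n absz_eq0.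
have := main N NP (leq_trans (leq_addl _ _) qN) cop.
have N0 : 0 < N%:R :> R by rewrite ltr0n.
rewrite lerBlDl -lerBlDr -/e ler_pdivlMr//.
apply/negP; rewrite -ltNge -ltr_pdivrMl// mulrC.
by rewrite (lt_le_trans qe)// ler_nat.
Qed.

End Slabs.

Section DiscrepancyBounds.
Variables (R : realType) (d : nat) (L : set 'rV[R]_d) (h : 'rV[int]_d).
Hypotheses (h0 : h != 0) (hL : dual_lattice L (real_vec R h)).

Lemma vol_ge0 (A : set 'rV[R]_d) : (0 <= vol A)%E.
Proof.
apply: le_ereal_inf_tmp => _ [ab _ <-]; apply: nneseries_ge0 => k _ _.
by rewrite lee_fin prodr_ge0// => i _; rewrite le_max lexx.
Qed.

Lemma vol_slab_le_discrepancy k :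
  (vol (slab h k) <= isotropic_discrepancy (lattice_points L))%E.
Proof.
have slab0 : slab h k `&` lattice_points L = set0.
  apply/seteqP; split=> // x [[_ /andP[kx xk]] [/hL/intrP[m xm] _]].
  by move: kx xk; rewrite xm !ltr_int; lia.
apply: ereal_sup_ubound; exists (slab h k); first exact: convex_slab.
rewrite slab0 /Defs.card fset_set0 cardfs0 mul0r sub0e abseN.
by rewrite gee0_abs ?vol_ge0.
Qed.

(** On the cube, <h, x> ranges between the sum of the negative coordinates of
    [h] and the sum of the positive ones, two integers at distance [norm1 h]. *)
Lemma discrepancy_ge_norm1 :
  ((1 / (norm1 h)%:R)%:E <= isotropic_discrepancy (lattice_points L))%E.
Proof.
have h1 := norm1_gt0 h0.
apply: (@le_slab_average R d h _ 1 (\sum_i Num.min (h 0 i) 0) (norm1 h)) => //;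
  last exact: vol_slab_le_discrepancy.
move=> N N0 _; rewrite mul1r -natrX ler_nat.
rewrite -[leqLHS](_ : #|{: {ffun 'I_d -> 'I_N}}| = _); last first.
  by rewrite card_ffun !card_ord.
rewrite -cardsT; apply/subset_leq_card/fintype.subsetP => c _; rewrite !inE.
rewrite /norm1 (big_morph Posz PoszD (erefl _)) -big_split/= !mulr_sumr.
rewrite /grid_dot; apply/andP; split; apply: ler_sum => i _.
- have := ltn_ord (c i); move: (nat_of_ord (c i)) (h 0 i) => a b; clear.
  by case: (leP b 0) => b0 aN; nia.
- have := ltn_ord (c i); move: (nat_of_ord (c i)) (h 0 i) => a b; clear.
  by case: (leP b 0) => b0 aN; nia.
Qed.

Lemma discrepancy_ge_norm2 (r : nat) : \sum_i h 0 i ^+ 2 <= r%:Z ^+ 2 ->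
  ((3 / 4 / (2 * r + 3)%:R)%:E <= isotropic_discrepancy (lattice_points L))%E.
Proof.
move=> hr.
have r0 : (0 < r)%N.
  have /rV0Pn[i hi] := h0.
  case: r hr => //; rewrite expr0n/= leNgt (bigD1 i)//= ltr_wpDr//.
    by apply: sumr_ge0 => j _; exact: sqr_ge0.
  by rewrite exprn_even_gt0.
apply: (@le_slab_average R d h _ (3 / 4)
  (((\sum_i h 0 i) %/ 2)%Z - 1 - r%:Z)) => //;
  [by rewrite addn_gt0 orbT | | exact: vol_slab_le_discrepancy].
move=> N N0 hN; have := card_grid_window N0 hN r0 hr.
rewrite -(ler_nat R) !natrM natrX; lra.
Qed.

End DiscrepancyBounds.

(** * Short vectors in the dual lattice *)

(** From the Smith form M = U D V: the matrix V^-1 U^T turns M into the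
    symmetric matrix U D U^T. *)
Lemma unimodular_symmetrizer (d : nat) (M : 'M[int]_d) :
  exists2 W : 'M[int]_d, W \in unitmx & (M *m W)^T = M *m W.
Proof.
have [U Uu [V Vu [e _ defM]]] := int_Smith_normal_form M.
pose D : 'M[int]_d := \matrix_(i, j) (e`_i *+ (i == j :> nat)).
have DT : D^T = D.
  by apply/matrixP => i j; rewrite !mxE eq_sym; case: eqP => // ->.
exists (invmx V *m U^T); first by rewrite unitmx_mul unitmx_inv unitmx_tr Vu.
have -> : M *m (invmx V *m U^T) = U *m D *m U^T.
  by rewrite defM mulmxA mulmxK.
by rewrite !trmx_mul DT trmxK mulmxA.
Qed.

Section DualPigeonhole.
Variables (R : realType) (d : nat).
Implicit Types (L : set 'rV[R]_d).

Lemma lattice_ofP (B : 'M[R]_d) (x : 'rV[R]_d) :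
  lattice_of B x <-> exists k : 'rV[int]_d, x = real_vec R k *m B.
Proof.
split=> [[k ->]|[k ->]].
  exists (\row_i k i); rewrite mulmx_sum_row.
  by apply: eq_bigr => i _; rewrite !mxE.
by exists (k 0); rewrite mulmx_sum_row; apply: eq_bigr => i _; rewrite mxE.
Qed.

Lemma integer_pointsP (x : 'rV[R]_d) :
  integer_points x <-> exists k : 'rV[int]_d, x = real_vec R k.
Proof.
split=> [xZ|[k ->] i]; last by rewrite mxE.
have /choice[k kP] i := elimT intrP (xZ i).
by exists (\row_i k i); apply/rowP => i; rewrite !mxE.
Qed.

Lemma dotE (x y : 'rV[R]_d) : dot x y = (x *m y^T) 0 0.
Proof. by rewrite mxE; apply: eq_bigr => i _; rewrite mxE. Qed.

(** The matrix [Q] induces an injection of the integer points modulo the dual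
    lattice into L modulo the integer points. If L is spanned by the rows of
    [M^-1] with [M] integral, the dual lattice is spanned by the rows of
    [M^T]; with [W] unimodular and [M W] symmetric, [Q = W^-1 M^-1] works
    because u Q = z means u = z M W = z W^T M^T. *)
Lemma integration_lattice_pairing L : integration_lattice L ->
  exists Q : 'M[R]_d, (forall u : 'rV[int]_d, L (real_vec R u *m Q)) /\
    (forall u : 'rV[int]_d, integer_points (real_vec R u *m Q) ->
       dual_lattice L (real_vec R u)).
Proof.
move=> [[B Bfree ->] ZL].
have Bu : B \in unitmx by rewrite -row_free_unit.
have /choice[k kP] (i : 'I_d) : exists k : 'rV[int]_d,
    delta_mx 0 i = real_vec R k *m B.
  apply/lattice_ofP/ZL/integer_pointsP.
  by exists (delta_mx 0 i); rewrite /real_vec map_delta_mx.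
pose M : 'M[int]_d := \matrix_i k i.
pose MR : 'M[R]_d := map_mx intr M.
have MB : MR *m B = 1%:M.
  apply/row_matrixP => i; rewrite row_mul row1 kP; congr (_ *m _).
  by apply/rowP => j; rewrite !mxE.
have [W Wu Wsym] := unimodular_symmetrizer M.
have intE (A : 'M[int]_d) (u : 'rV[int]_d) :
  real_vec R u *m map_mx intr A = real_vec R (u *m A) by rewrite -map_mxM.
exists (map_mx intr (invmx W) *m B); split=> u.
  by apply/lattice_ofP; exists (u *m invmx W); rewrite mulmxA intE.
move=> /integer_pointsP[z]; rewrite mulmxA intE => uz x /lattice_ofP[w ->].
have -> : real_vec R u = real_vec R z *m map_mx intr (M *m W).
  rewrite -uz map_mxM mulmxA -(mulmxA _ B) (mulmx1C MB) mulmx1 intE.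
  by rewrite mulmxKV.
rewrite dotE -mulmxA.
have -> : map_mx intr (M *m W) *m (real_vec R w *m B)^T =
    map_mx intr (W^T) *m (real_vec R w)^T.
  rewrite -Wsym !trmx_mul map_mxM mulmxA; congr (_ *m _).
  by rewrite -mulmxA -(map_trmx _ M) -trmx_mul (mulmx1C MB) trmx1 mulmx1.
rewrite /real_vec map_trmx -!map_mxM mxE; exact: intr_int.
Qed.

Lemma dual_pigeonhole L n (F : seq 'rV[int]_d) :
  integration_lattice L -> (lattice_points L #= `I_n)%card ->
  uniq F -> (n < size F)%N ->
  exists u v, [/\ u \in F, v \in F, u != v &
    dual_lattice L (real_vec R (u - v))].
Proof.
move=> iL Pn uF nF; have [Q [QL Qdual]] := integration_lattice_pairing iL.
pose frac (x : 'rV[R]_d) : 'rV[R]_d :=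
  x - real_vec R (\row_i Num.floor (x 0 i)).
have fracE x i : frac x 0 i = x 0 i - (Num.floor (x 0 i))%:~R.
  by rewrite !mxE.
pose Psi u := frac (real_vec R u *m Q).
have LB x y : L x -> L y -> L (x - y).
  case: iL => -[B _ ->] _ /lattice_ofP[k ->] /lattice_ofP[l ->].
  by apply/lattice_ofP; exists (k - l); rewrite -mulmxBl /real_vec map_mxB.
have PsiP u : lattice_points L (Psi u).
  split.
    by apply: LB (QL u) _; case: iL => _; apply; apply/integer_pointsP; eexists.
  move=> i; rewrite fracE.
  by have := floor_itv ((real_vec R u *m Q) 0 i); rewrite intrD1; lra.
have finP : finite_set (lattice_points L) by apply/finite_setP; exists n.
have : ~~ uniq (map Psi F).
  apply: contraL nF => uPsi; rewrite -leqNgt -(card_fset_set Pn).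
  rewrite -(size_map Psi); apply: uniq_leq_size => // _ /mapP[u _ ->].
  by rewrite in_fset_set// mem_set.
move=> /(uniqPn 0)[i [j [ij]]]; rewrite size_map => jF.
have iF := ltn_trans ij jF.
rewrite !(nth_map 0)// => Psi_ij.
exists F`_i, F`_j; rewrite !mem_nth// nth_uniq// ltn_eqF//; split=> //.
apply: Qdual; rewrite /real_vec map_mxB mulmxBl.
apply/integer_pointsP; exists
  (\row_l Num.floor ((real_vec R F`_i *m Q) 0 l) -
   \row_l Num.floor ((real_vec R F`_j *m Q) 0 l)).
move: Psi_ij; rewrite /Psi /frac.
set ki := \row_l _; set kj := \row_l _ => Psi_ij.
rewrite [RHS]map_mxB -[LHS](subrK (real_vec R ki)) [_ - _ - _]addrAC.
by rewrite Psi_ij [_ - _ - _]addrAC subrr add0r addrC.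
Qed.

End DualPigeonhole.

Section ShortDualVectors.
Variables (R : realType) (d n : nat) (L : set 'rV[R]_d).
Hypotheses (iL : integration_lattice L) (Pn : (lattice_points L #= `I_n)%card).

(** The points of [l1_balls] with [s] the integer part of the d-th root of d!
    n are more than [n], and their differences have l1-norm at most [s]. *)
Lemma short_dual_norm1 : (0 < d)%N ->
  exists u : 'rV[int]_d, [/\ u != 0, dual_lattice L (real_vec R u) &
    (norm1 u ^ d <= d`! * n)%N].
Proof.
case: d L iL Pn => // d' L' iL' Pn' _.
have [s sd ds] := exists_floor_root (d'.+1`! * n) (ltn0Sn d').
pose vec (z : seq int) : 'rV[int]_d'.+1 := \row_i z`_i.
pose F := map vec (l1_balls d' s).
have uF : uniq F.
  rewrite map_inj_in_uniq ?uniq_l1_balls// => z w.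
  move=> /size_l1_balls_mem zd /size_l1_balls_mem wd /rowP zw.
  apply: (@eq_from_nth _ 0); rewrite zd ?wd// => i id.
  by have := zw (Ordinal id); rewrite !mxE.
have nF : (n < size F)%N.
  have := leq_trans ds (size_l1_balls d' s).
  by rewrite size_map ltn_pmul2l ?fact_gt0.
have [_ [_ [/mapP[z zs ->] /mapP[w ws ->] zw zwL]]] :=
  dual_pigeonhole iL' Pn' uF nF.
exists (vec z - vec w); split=> //; first by rewrite subr_eq0.
apply: leq_trans sd; rewrite leq_exp2r//.
have := l1_balls_dist erefl zs ws; rewrite addnn leq_double.
apply: leq_trans; rewrite /norm1 leq_eqVlt; apply/orP; left; apply/eqP.
by apply: eq_bigr => i _; rewrite !mxE.
Qed.

Lemma short_dual_sup : (0 < d)%N ->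
  exists (u : 'rV[int]_d) (q : nat), [/\ u != 0, dual_lattice L (real_vec R u),
    (forall i, `|u 0%R i| <= q)%N & (q ^ d <= n)%N].
Proof.
move=> d0; have [q qd dq] := exists_floor_root n d0.
pose vec (e : {ffun 'I_d -> 'I_q.+1}) : 'rV[int]_d := \row_i (e i)%:Z.
pose F := map vec (enum {: {ffun 'I_d -> 'I_q.+1}}).
have uF : uniq F.
  rewrite map_inj_uniq ?enum_uniq// => e e' /rowP ee'; apply/ffunP => i.
  by apply/val_inj; have := ee' i; rewrite !mxE => -[].
have nF : (n < size F)%N by rewrite size_map -cardE card_ffun !card_ord.
have [_ [_ [/mapP[e _ ->] /mapP[f _ ->] ef efL]]] :=
  dual_pigeonhole iL Pn uF nF.
exists (vec e - vec f), q; split=> // [|i]; first by rewrite subr_eq0.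
rewrite !mxE; have := ltn_ord (e i); have := ltn_ord (f i).
by move: (nat_of_ord (e i)) (nat_of_ord (f i)) => a b; clear; lia.
Qed.

End ShortDualVectors.

(** * A lower bound for the Gamma function *)

Section GammaLowerBound.
Variable R : realType.
Local Notation mu := (@lebesgue_measure R).

(** Young's inequality for the product [x * 1] with exponents [s] and its
    conjugate. *)
Lemma bernoulli_powR (s x : R) : 1 <= s -> 0 <= x ->
  1 + s * (x - 1) <= x `^ s.
Proof.
move=> s1 x0; have [<-|s_neq1] := eqVneq 1 s; first by rewrite powRr1//; lra.
have {s_neq1}s_gt1 : 1 < s by rewrite lt_neqAle s_neq1.
have s0 : 0 < s by lra.
have q0 : 0 < 1 - s^-1 by rewrite subr_gt0 invf_lt1.
have := @conjugate_powR R x 1 s (1 - s^-1)^-1 x0 ler01 s0.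
rewrite invr_gt0 invrK subrKC powR1 mulr1 mul1r => /(_ q0 erefl).
rewrite -(ler_pM2r s0) mulrDl divfK ?gt_eqF// mulrBl mulVf ?gt_eqF//.
lra.
Qed.

Lemma powR_ge_tangent (s t : R) : 1 <= s -> 0 <= t ->
  s `^ s * (t - s + 1) <= t `^ s.
Proof.
move=> s1 t0; have s0 : 0 < s by lra.
have := bernoulli_powR s1 (divr_ge0 t0 (ltW s0)).
have -> : 1 + s * (t / s - 1) = t - s + 1 by field; rewrite gt_eqF.
rewrite powRM ?invr_ge0 ?(ltW s0)// -(powR_inv1 (ltW s0)) -powRrM mulN1r powRN.
by rewrite ler_pdivlMr ?powR_gt0// mulrC.
Qed.

Lemma cvg_expR_half : expR (- (t / 2)) @[t --> +oo] --> (0 : R).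
Proof.
rewrite (_ : (fun t : R => _) = (fun z => expR (- z)) \o (fun z => 2^-1 * z)).
  apply: (@cvg_comp _ _ _ _ _ _ (pinfty_nbhs R)); last exact: cvgr_expR.
  exact: gt0_cvgMry.
by apply: eq_fun => x; rewrite mulrC.
Qed.

Lemma is_derive_expR_half (t : R) :
  is_derive t 1 (fun t => - 2 * expR (- (t / 2))) (expR (- (t / 2))).
Proof.
apply: is_derive_eq.
rewrite /GRing.scale/=; lra.
Qed.

Lemma is_derive_gamma2 (s t : R) :
  is_derive t 1 (fun t => - ((t - s + 2) * expR (- t)))
    ((t - s + 1) * expR (- t)).
Proof.
apply: is_derive_eq.
rewrite /GRing.scale/=; lra.
Qed.

Lemma is_derive_continuous (F f : R -> R) :
  (forall t : R, is_derive t (1 : R) F (f t)) -> continuous F.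
Proof.
by move=> dF t; apply/differentiable_continuous/derivable1_diffP; case: (dF t).
Qed.

Lemma ge0_integral_antiderivative (F f : R -> R) (a : R) :
  (forall t : R, is_derive t (1 : R) F (f t)) -> continuous f ->
  (forall t, a <= t -> 0 <= f t) -> F t @[t --> +oo] --> (0 : R) ->
  (\int[mu]_(t in `[a, +oo[) (f t)%:E = (- F a)%:E)%E.
Proof.
move=> dF cf f0 F0; rewrite (@ge0_continuous_FTC2y _ _ F _ 0)//.
- by rewrite sub0e.
- exact: continuous_subspaceT.
- by apply: cvg_at_right_filter; exact: (is_derive_continuous dF).
- by move=> x _; rewrite derive1E; case: (dF x).
Qed.

Lemma continuous_expR_half : continuous (fun t : R => expR (- (t / 2))).
Proof.
apply: (@is_derive_continuous _ (fun t => - 2^-1 * expR (- (t / 2)))) => t.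
by apply: is_derive_eq; rewrite /GRing.scale/=; lra.
Qed.

Lemma continuous_gamma_tail (s : R) :
  continuous (fun t : R => (t - s + 1) * expR (- t)).
Proof.
apply: (@is_derive_continuous _ (fun t => (s - t) * expR (- t))) => t.
by apply: is_derive_eq; rewrite /GRing.scale/=; lra.
Qed.

Lemma measurable_continuous_EFin (D : set R) (f : R -> R) : continuous f ->
  measurable_fun D (fun t => (f t)%:E).
Proof.
move=> cf; apply/measurable_EFinP; apply: measurable_funTS.
exact: continuous_measurable_fun.
Qed.

Lemma integral_expR_half :
  (\int[mu]_(t in `[0%R, +oo[) (expR (- (t / 2)))%:E = 2%:E)%E.
Proof.
rewrite (ge0_integral_antiderivative is_derive_expR_half).
- by rewrite mul0r oppr0 expR0 mulr1 opprK.
- exact: continuous_expR_half.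
- by move=> t _; exact: expR_ge0.
- by rewrite -[X in _ --> X](mulr0 (- 2)); apply: cvgMr; exact: cvg_expR_half.
Qed.

(** The integrand is minus the derivative of (t - s + 2) exp(-t). *)
Lemma integral_gamma_tail (s : R) : 1 <= s ->
  (\int[mu]_(t in `[s, +oo[) ((t - s + 1) * expR (- t))%:E =
    (2 * expR (- s))%:E)%E.
Proof.
move=> s1.
rewrite (ge0_integral_antiderivative (is_derive_gamma2 s)).
- by rewrite subrr add0r opprK.
- exact: continuous_gamma_tail.
- by move=> t st; rewrite mulr_ge0 ?expR_ge0//; lra.
rewrite -oppr0; apply: cvgN.
apply: (@squeeze_cvgr _ _ _ _ (fun=> 0) (fun t => 2 * expR (- (t / 2)))).
- near=> t.
  have t_ge : s <= t by near: t; apply: nbhs_pinfty_ge; rewrite num_real.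
  rewrite mulr_ge0 ?expR_ge0//=; last by lra.
  have -> : expR (- t) = expR (- (t / 2)) * expR (- (t / 2)).
    by rewrite -expRD; congr expR; lra.
  rewrite mulrA ler_pM2r ?expR_gt0// expRN ler_pdivrMr ?expR_gt0//.
  by have := expR_ge1Dx (t / 2); lra.
- exact: cvg_cst.
- by rewrite -[X in _ --> X](mulr0 2); apply: cvgMr; exact: cvg_expR_half.
Unshelve. all: by end_near. Qed.

(** Beyond [s], replace t^s by its tangent at [s], which gives an integral in
    closed form. As the definition of [Gamma] returns 0 for a divergent
    integral, convergence is needed as well: t^s is at most (2s)^s exp(t/2). *)
Lemma Gamma_ge (s : R) : 1 <= s -> 2 * (s `^ s * expR (- s)) <= Gamma (s + 1).
Proof.
move=> s1; have s0 : 0 < s by lra.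
pose g t : R := t `^ s * expR (- t).
have g0 t : 0 <= g t by rewrite mulr_ge0 ?powR_ge0 ?expR_ge0.
have mg D : measurable_fun D (fun t => (g t)%:E).
  apply/measurable_EFinP/measurable_funTS/measurable_funM.
    exact: measurable_powR.
  by apply: measurableT_comp => //; exact: measurable_funN.
have -> : Gamma (s + 1) = fine (\int[mu]_(t in `]0%R, +oo[) (g t)%:E).
  by rewrite /Gamma /Rintegral addrK.
have lower : ((2 * (s `^ s * expR (- s)))%:E <=
    \int[mu]_(t in `]0%R, +oo[) (g t)%:E)%E.
  rewrite mulrCA EFinM -integral_gamma_tail//.
  rewrite -ge0_integralZl_EFin//=; last 3 first.
  - move=> t; rewrite in_itv/= andbT => st.
    by rewrite lee_fin mulr_ge0 ?expR_ge0//; lra.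
  - exact: measurable_continuous_EFin (@continuous_gamma_tail s).
  - exact: powR_ge0.
  apply: (@le_trans _ _ (\int[mu]_(t in `[s, +oo[) (g t)%:E)%E).
    apply: ge0_le_integral => //=.
    - move=> t; rewrite in_itv/= andbT => st.
      rewrite -EFinM lee_fin !mulr_ge0 ?expR_ge0 ?powR_ge0//; lra.
    - apply: (@measurable_continuous_EFin _
        (fun t => s `^ s * ((t - s + 1) * expR (- t)))) => t.
      by apply: cvgM; [exact: cvg_cst|exact: continuous_gamma_tail].
    - exact: mg.
    - move=> t; rewrite in_itv/= andbT => st.
      rewrite -EFinM lee_fin mulrA ler_pM2r ?expR_gt0//.
      by apply: powR_ge_tangent => //; lra.
  apply: ge0_subset_integral => //=.
  - exact: mg.
  - by move=> t _; rewrite lee_fin.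
  - by move=> t /=; rewrite !in_itv/= !andbT; lra.
have upper : (\int[mu]_(t in `]0%R, +oo[) (g t)%:E < +oo)%E.
  apply: (@le_lt_trans _ _ ((2 * s) `^ s * 2)%:E); last exact: ltry.
  rewrite EFinM -integral_expR_half -ge0_integralZl_EFin//=; last 2 first.
  - exact: measurable_continuous_EFin continuous_expR_half.
  - exact: powR_ge0.
  apply: (@le_trans _ _ (\int[mu]_(t in `[0%R, +oo[) (g t)%:E)%E).
    apply: ge0_subset_integral => //=.
    - exact: mg.
    - by move=> t _; rewrite lee_fin.
    - by move=> t /=; rewrite !in_itv/= !andbT; exact: ltW.
  apply: ge0_le_integral => //=.
  - by move=> t _; rewrite lee_fin.
  - exact: mg.
  - apply: (@measurable_continuous_EFin _
      (fun t => (2 * s) `^ s * expR (- (t / 2)))) => t.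
    by apply: cvgM; [exact: cvg_cst|exact: continuous_expR_half].
  move=> t; rewrite in_itv/= andbT => t0; rewrite -EFinM lee_fin /g.
  have -> : expR (- t) = expR (- (t / 2)) * expR (- (t / 2)).
    by rewrite -expRD; congr expR; lra.
  rewrite mulrA ler_pM2r ?expR_gt0// expRN ler_pdivrMr ?expR_gt0//.
  have -> : expR (t / 2) = expR (t / (2 * s)) `^ s.
    by rewrite -expRM; congr expR; field; rewrite gt_eqF.
  rewrite -powRM ?expR_ge0//; last by lra.
  apply: ge0_ler_powR; rewrite ?nnegrE ?mulr_ge0 ?expR_ge0//; try lra.
  rewrite mulrC -ler_pdivrMr; last by lra.
  by have := expR_ge1Dx (t / (2 * s)); lra.
rewrite -lee_fin fineK// ge0_fin_numE// integral_ge0// => t _.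
by rewrite lee_fin.
Qed.

End GammaLowerBound.

(** * Numerical estimates *)

Section NumericalBounds.
Variable R : realType.

Lemma atan_le (x : R) : 0 <= x -> atan x <= x.
Proof.
move=> x0.
have dat (t : R) : t \in `]0, x[%R -> is_derive t 1 atan (1 + t ^+ 2)^-1.
  by move=> _; exact: is_derive1_atan.
have [|c _] := MVT_segment x0 dat.
  by apply: continuous_subspaceT => t; exact: continuous_atan.
rewrite atan0 !subr0 => ->; rewrite ler_piMl// invf_le1; last first.
  by rewrite ltr_pwDl// sqr_ge0.
by rewrite lerDl sqr_ge0.
Qed.

(** From pi / 4 = atan (1/2) + atan (1/3), Euler's formula. *)
Lemma pi_le : pi <= 10 / 3 :> R.
Proof.
have cos_atan_neq0 (x : R) : cos (atan x) != 0.
  by rewrite cos_atan invr_eq0 gt_eqF// sqrtr_gt0 ltr_pwDl// sqr_ge0.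
have a2 := @atan_le (1 / 2) ltac:(lra).
have a3 := @atan_le (1 / 3) ltac:(lra).
have a20 : 0 <= atan (1 / 2 : R) by rewrite -(atan0 R) le_atan//; lra.
have a30 : 0 <= atan (1 / 3 : R) by rewrite -(atan0 R) le_atan//; lra.
have : tan (atan (1 / 2) + atan (1 / 3)) = 1 :> R.
  by rewrite tanD// !atanK; field.
move=> /(congr1 atan); rewrite tanK ?atan1; last first.
  by rewrite in_itv/=; have := @pihalf_ge1 R; lra.
lra.
Qed.

(** Start from exp(-1/64) >= 63/64 and square six times, rounding down to a
    fraction with small terms at each step. *)
Lemma expR1_le : expR 1 <= 11 / 4 :> R.
Proof.
have sq (x a b : R) : 0 <= a -> a <= expR (- x) -> b <= a ^+ 2 ->
    forall z, z = 2 * x -> b <= expR (- z).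
  move=> a0 ax bsq z ->; apply: le_trans bsq _.
  have -> : expR (- (2 * x)) = expR (- x) ^+ 2.
    by rewrite expr2 -expRD; congr expR; lra.
  by rewrite ler_pXn2r// ?nnegrE ?expR_ge0.
have e1 : 63 / 64 <= expR (- (1 / 64)) :> R.
  by have := expR_ge1Dx (- (1 / 64) : R); lra.
have e2 : 125 / 129 <= expR (- (1 / 32)) :> R.
  by apply: (sq (1 / 64) (63 / 64)) e1 _ _ _; lra.
have e3 : 1015 / 1081 <= expR (- (1 / 16)) :> R.
  by apply: (sq (1 / 32) (125 / 129)) e2 _ _ _; lra.
have e4 : 916 / 1039 <= expR (- (1 / 8)) :> R.
  by apply: (sq (1 / 16) (1015 / 1081)) e3 _ _ _; lra.
have e5 : 813 / 1046 <= expR (- (1 / 4)) :> R.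
  by apply: (sq (1 / 8) (916 / 1039)) e4 _ _ _; lra.
have e6 : 676 / 1119 <= expR (- (1 / 2)) :> R.
  by apply: (sq (1 / 4) (813 / 1046)) e5 _ _ _; lra.
have e7 : 4 / 11 <= expR (- (1 / 1)) :> R.
  by apply: (sq (1 / 2) (676 / 1119)) e6 _ _ _; lra.
move: e7; rewrite divr1.
rewrite expRN -[4 / 11]invf_div lef_pV2 ?posrE ?expR_gt0//; lra.
Qed.

Lemma bernoulli2 (y : R) (k : nat) : 0 <= y ->
  1 + k%:R * y + k%:R * (k%:R - 1) / 2 * y ^+ 2 <= (1 + y) ^+ k.
Proof.
move=> y0; elim: k => [|k IH]; first by rewrite expr0; lra.
have y1 : 0 <= 1 + y by lra.
rewrite [in leRHS]exprSr; apply: (le_trans _ (ler_wpM2r y1 IH)).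
have k0 : 0 <= k%:R * (k%:R - 1) / 2 :> R.
  case: k {IH} => [|k]; first by lra.
  by rewrite -natr1; have := ler0n R k; nra.
have : 0 <= k%:R * (k%:R - 1) / 2 * y ^+ 3 by rewrite mulr_ge0 ?exprn_ge0.
by rewrite -(natr1 k); move: (k%:R : R) => K; lra.
Qed.

(** The constant 429/100 exceeds sqrt (2 e pi) when e and pi are replaced by
    their upper bounds 11/4 and 10/3, and is small enough for the induction
    to start at 2. *)
Lemma fact_pow_le (d : nat) : (2 <= d)%N ->
  d`!%:R * (429 / 100) ^+ d <= 2 * (2 * d%:R + 1) ^+ d :> R.
Proof.
case: d => [//|[//|d]] _; elim: d => [|d IH].
  by rewrite (_ : 2`! = 2%N)//; lra.
move: d.+2 (isT : (2 <= d.+2)%N) IH => {d} k k2 IH; rewrite factS natrM !exprS.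
set x : R := k%:R in IH *; have kx : k.+1%:R = x + 1 by rewrite natr1.
have x2 : 2 <= x by rewrite /x ler_nat.
have x0 : 0 < 2 * x + 1 by lra.
set y := 2 / (2 * x + 1); have y0 : 0 <= y by rewrite divr_ge0//; lra.
have Ey : 2 * (x + 1) + 1 = (2 * x + 1) * (1 + y).
  by rewrite /y; field; rewrite gt_eqF.
rewrite kx [in leRHS]Ey [in leRHS]exprMn.
have -> : 2 * ((2 * x + 1) * (1 + y) * ((2 * x + 1) ^+ k * (1 + y) ^+ k)) =
  2 * (2 * x + 1) ^+ k * ((2 * x + 1) * (1 + y) * (1 + y) ^+ k) by ring.
have -> : (x + 1) * k`!%:R * (429 / 100 * (429 / 100) ^+ k) =
  k`!%:R * (429 / 100) ^+ k * ((x + 1) * (429 / 100)) by ring.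
apply: ler_pM; [| |exact: IH|].
- by apply: mulr_ge0; [exact: ler0n|apply: exprn_ge0; lra].
- by apply: mulr_ge0; lra.
have y1 : 0 <= (2 * x + 1) * (1 + y) by rewrite mulr_ge0//; lra.
apply: (le_trans _ (ler_wpM2l y1 (bernoulli2 k y0))).
rewrite -Ey -/x -subr_ge0.
have -> : (2 * (x + 1) + 1) * (1 + x * y + x * (x - 1) / 2 * y ^+ 2) -
     (x + 1) * (429 / 100) =
    (284 / 100 * x ^+ 3 + 368 / 100 * x ^+ 2 - 745 / 100 * x - 129 / 100) /
      (2 * x + 1) ^+ 2.
    by rewrite /y; field; rewrite gt_eqF.
have xsq : 4 <= x ^+ 2 by rewrite expr2; nra.
have xcube : 4 * x <= x ^+ 3 by rewrite exprSr ler_wpM2r//; lra.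
by apply: divr_ge0; [lra|exact: sqr_ge0].
Qed.

(** The d-th root of (s/e)^s for s = d/2, from Stirling's formula. *)
Definition gamma_root (d : nat) : R := Num.sqrt (d%:R / (2 * expR 1)).

Lemma gamma_root_sqr d : gamma_root d ^+ 2 = d%:R / (2 * expR 1).
Proof. by rewrite sqr_sqrtr// divr_ge0// mulr_ge0// expR_ge0. Qed.

Lemma Gamma_ge_root (d : nat) : (2 <= d)%N ->
  2 * gamma_root d ^+ d <= Gamma (d%:R / 2 + 1).
Proof.
move=> d2; have d2R : 2 <= d%:R :> R by rewrite ler_nat.
have s1 : 1 <= d%:R / 2 :> R by lra.
apply: (le_trans _ (Gamma_ge s1)).
rewrite ler_pM2l// le_eqVlt; apply/orP; left; apply/eqP.
rewrite /gamma_root -powR12_sqrt; last first.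
  by rewrite divr_ge0// mulr_ge0// expR_ge0.
rewrite -powR_mulrn ?powR_ge0// -powRrM.
have -> : d%:R / (2 * expR 1) = d%:R / 2 * expR (- 1) :> R.
  by rewrite expRN; field; rewrite gt_eqF ?expR_gt0.
rewrite powRM; [|by lra|exact: expR_ge0].
rewrite -expRM (_ : 2^-1 * d%:R = d%:R / 2); last by rewrite mulrC.
by rewrite mulN1r.
Qed.

Lemma Gamma_half_gt0 (d : nat) : (2 <= d)%N ->
  0 < Gamma (d%:R / 2 + 1) :> R.
Proof.
move=> d2; apply: lt_le_trans (Gamma_ge_root d2).
rewrite mulr_gt0// exprn_gt0// sqrtr_gt0 divr_gt0 ?mulr_gt0 ?expR_gt0//.
by rewrite ltr0n ltnW.
Qed.

(** After division by the lower bound for [Gamma], the square root of pi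
    becomes sqrt (2 e pi / d), and [fact_pow_le] applies. *)
Lemma fact_pi_le_Gamma (d : nat) : (2 <= d)%N ->
  d`!%:R * Num.sqrt pi ^+ d <=
    (2 * Num.sqrt d%:R + 1) ^+ d * Gamma (d%:R / 2 + 1) :> R.
Proof.
move=> d2; have d2R : 2 <= d%:R :> R by rewrite ler_nat.
have w0 : 0 <= gamma_root d by exact: sqrtr_ge0.
set w := gamma_root d in w0 *.
set sd := Num.sqrt d%:R : R.
have sdsq : sd ^+ 2 = d%:R by rewrite sqr_sqrtr//; lra.
have sd1 : 1 <= sd by rewrite -sqrtr1 ler_sqrt//; lra.
pose c : R := 429 / 100.
have c0 : 0 <= c by rewrite /c; lra.
have c2 : 10 / 3 * (2 * (11 / 4)) <= c ^+ 2 by rewrite /c; lra.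
have := fact_pow_le d2; rewrite -/c; clearbody c => fact_le.
have wsd0 : 0 <= w / sd by rewrite divr_ge0//; lra.
have piw : Num.sqrt pi <= c * (w / sd).
  rewrite mulrA ler_pdivlMr; last by lra.
  have w2 : w ^+ 2 * (2 * expR 1) = d%:R.
    by rewrite gamma_root_sqr divfK// mulf_neq0// gt_eqF// expR_gt0.
  have pie : pi * (2 * expR 1) <= c ^+ 2.
    apply: le_trans c2; apply: ler_pM; [exact: pi_ge0| |exact: pi_le|].
      by rewrite mulr_ge0// expR_ge0.
    by rewrite ler_pM2l// expR1_le.
  have sd0 : 0 <= sd by lra.
  rewrite -ler_sqr ?nnegrE ?mulr_ge0 ?sqrtr_ge0// exprMn sqr_sqrtr ?pi_ge0//.
  rewrite sdsq -w2 mulrCA mulrC exprMn ler_wpM2r ?sqr_ge0//.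
have sd2 : 0 <= (2 * sd + 1) ^+ d by rewrite exprn_ge0//; lra.
apply: (le_trans _ (ler_wpM2l sd2 (Gamma_ge_root d2))).
apply: (@le_trans _ _ (d`!%:R * c ^+ d * (w / sd) ^+ d)).
  rewrite -mulrA ler_wpM2l// -exprMn lerXn2r ?nnegrE ?sqrtr_ge0//.
  exact: mulr_ge0.
apply: le_trans (ler_wpM2r _ fact_le) _; first exact: exprn_ge0.
rewrite [leRHS]mulrCA -mulrA ler_pM2l// -!exprMn lerXn2r ?nnegrE//.
- by rewrite mulr_ge0//; lra.
- by rewrite mulr_ge0//; lra.
rewrite mulrA ler_pdivrMr; last by lra.
by rewrite -sdsq mulrAC ler_wpM2r//; nra.
Qed.

End NumericalBounds.

(** * The discrepancy of lattice point sets *)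

Section Assembly.
Variables (R : realType) (d n : nat) (L : set 'rV[R]_d).
Hypotheses (d2 : (2 <= d)%N) (iL : integration_lattice L).
Hypothesis (Pn : (lattice_points L #= `I_n)%card).

Let d0 : (0 < d)%N. Proof. exact: ltnW. Qed.

Lemma root_exprn (a : R) : 0 <= a -> (a `^ (1 / d%:R)) ^+ d = a.
Proof.
move=> a0; rewrite -powR_mulrn ?powR_ge0// -powRrM divfK ?powRr1//.
by rewrite pnatr_eq0 -lt0n.
Qed.

Local Notation nth_root := ((n%:R : R) `^ (1 / d%:R)).

Lemma discrepancy_ge_c_d :
  ((c_d R d / nth_root)%:E <= isotropic_discrepancy (lattice_points L))%E.
Proof.
have [u [u0 uL un]] := short_dual_norm1 iL Pn d0.
apply: le_trans (discrepancy_ge_norm1 u0 uL); rewrite lee_fin.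
have s0 := norm1_gt0 u0.
have n0 : (0 < n)%N.
  have : (0 < norm1 u ^ d)%N by rewrite expn_gt0 s0.
  by move=> /leq_trans/(_ un); rewrite muln_gt0 => /andP[].
set s : R := (norm1 u)%:R; have sR0 : 0 < s by rewrite ltr0n.
have Y0 : 0 < nth_root by rewrite powR_gt0// ltr0n.
have sd0 : 0 <= Num.sqrt d%:R :> R by exact: sqrtr_ge0.
have G0 := Gamma_half_gt0 R d2.
rewrite /c_d /Gamma_factor powRN.
set G := Gamma _ in G0 *; pose X := G `^ (1 / d%:R).
have X0 : 0 < X by rewrite powR_gt0.
rewrite -/X; set a := 2 * _ + 1; have a0 : 0 < a by rewrite /a; lra.
have -> : Num.sqrt pi / a * X^-1 / nth_root = Num.sqrt pi / (a * X * nth_root).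
  by field; rewrite !gt_eqF.
rewrite ler_pdivrMr ?mulr_gt0// div1r ler_pdivlMl//.
rewrite -(@ler_pXn2r _ d) ?nnegrE ?mulr_ge0 ?sqrtr_ge0 ?(ltW sR0) ?(ltW a0)
  ?(ltW X0) ?(ltW Y0)//.
rewrite !exprMn !root_exprn ?ler0n ?(ltW G0)//.
have le1 : s ^+ d <= d`!%:R * n%:R by rewrite /s -natrX -natrM ler_nat.
have := fact_pi_le_Gamma R d2; rewrite -/G -/a => le2.
apply: le_trans (ler_wpM2r (exprn_ge0 _ (sqrtr_ge0 _)) le1) _.
rewrite [leLHS]mulrAC.
exact: (ler_wpM2r (ler0n R n) le2).
Qed.

(** The Euclidean norm of the short vector is at most sqrt d times its sup
    norm; [r] is an integer above this bound, as required for the number [2 r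
    + 3] of slabs. *)
Lemma discrepancy_ge_c_d' :
  ((c_d' (1 / 24 : R) d / nth_root)%:E
     <= isotropic_discrepancy (lattice_points L))%E.
Proof.
have [u [q [u0 uL uq qn]]] := short_dual_sup iL Pn d0.
have q0 : (0 < q)%N.
  have /rV0Pn[i ui] := u0.
  by apply: leq_trans (uq i); rewrite lt0n absz_eq0.
have n0 : (0 < n)%N by apply: leq_trans qn; rewrite expn_gt0 q0.
set sd : R := Num.sqrt d%:R.
have sdsq : sd ^+ 2 = d%:R by rewrite sqr_sqrtr.
have sd1 : 1 <= sd by rewrite -sqrtr1 ler_sqrt// ler1n.
pose r := (Num.truncn (sd * q%:R)).+1.
have qR : 1 <= q%:R :> R by rewrite ler1n.
have sdq1 : 1 <= sd * q%:R by nra.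
have r_gt : sd * q%:R < r%:R by exact: truncnS_gt.
have r_le : r%:R <= sd * q%:R + 1.
  by rewrite -natr1 lerD2r truncn_le//; lra.
have ur : \sum_i u 0 i ^+ 2 <= r%:Z ^+ 2.
  apply: (@le_trans _ _ (d%:Z * q%:Z ^+ 2)).
    rewrite -[X in X%:Z * _]card_ord -natz mulr_natl -sumr_const.
    by apply: ler_sum => i _; have := uq i; move: (u _ _) => a; nia.
  rewrite -(ler_int R) rmorphM !rmorphXn/= -!pmulrn -sdsq -exprMn.
  by rewrite lerXn2r ?nnegrE ?ltW//; lra.
apply: le_trans (discrepancy_ge_norm2 u0 uL ur); rewrite lee_fin.
have Y0 : 0 < nth_root by rewrite powR_gt0// ltr0n.
have qY : q%:R <= nth_root.
  rewrite -(@ler_pXn2r _ d) ?nnegrE ?(ltW Y0)// root_exprn//.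
  by rewrite -natrX ler_nat.
have G0 := Gamma_half_gt0 R d2.
rewrite /c_d' /Gamma_factor powRN.
have Gw := Gamma_ge_root R d2.
set G := Gamma _ in G0 Gw *; pose X := G `^ (1 / d%:R).
have X0 : 0 < X by rewrite powR_gt0.
have w0 : 0 <= gamma_root R d by exact: sqrtr_ge0.
have wX : gamma_root R d <= X.
  rewrite -(@ler_pXn2r _ d) ?nnegrE ?(ltW X0)// root_exprn ?(ltW G0)//.
  by have := exprn_ge0 d w0; lra.
have wsd : 10 / 24 * sd <= gamma_root R d.
  rewrite -ler_sqr ?nnegrE//; last by lra.
  rewrite gamma_root_sqr exprMn sdsq mulrC ler_wpM2l ?ler0n//.
  have -> : (10 / 24 : R) ^+ 2 = (144 / 25)^-1 by field.
  rewrite lef_pV2 ?posrE ?mulr_gt0 ?expR_gt0//.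
  by have := expR1_le R; lra.
rewrite -/X natrD natrM.
have -> : 1 / 24 * X^-1 / nth_root = 1 / 24 / (X * nth_root).
  by field; rewrite !gt_eqF.
have XY : 10 / 24 * sd * q%:R <= X * nth_root.
  by apply: ler_pM => //; [lra|exact: le_trans wX].
have sdq0 : 0 < sd * q%:R by lra.
apply: (@le_trans _ _ (1 / 10 / (sd * q%:R))).
  rewrite ler_pdivrMr ?mulr_gt0// mulrAC ler_pdivlMr//. lra.
rewrite ler_pdivlMr; last by lra.
by rewrite mulrAC ler_pdivrMr//; lra.
Qed.

End Assembly.

Theorem theorem6p3 (R : realType) :
  (forall (d n : nat) (L : set 'rV[R]_d),
     (2 <= d)%N -> integration_lattice L -> (lattice_points L #= `I_n)%card ->
     ((Num.min (1 / (2 * Num.sqrt d%:R + 1)) (c_d R d / n%:R `^ (1 / d%:R)))%:E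
        <= isotropic_discrepancy (lattice_points L))%E)
  /\
  (exists2 c : R, 0 < c &
   forall (d n : nat) (L : set 'rV[R]_d),
     (2 <= d)%N -> integration_lattice L -> (lattice_points L #= `I_n)%card ->
     spectral_test L <= 1 / 2 ->
     ((Num.min (1 / (2 * Num.sqrt d%:R + 1)) (c_d' c d / n%:R `^ (1 / d%:R)))%:E
        <= isotropic_discrepancy (lattice_points L))%E).
Proof.
split=> [d n L d2 iL Pn|].
  apply: le_trans (discrepancy_ge_c_d d2 iL Pn).
  by rewrite lee_fin ge_min lexx orbT.
exists (1 / 24); first by lra.
move=> d n L d2 iL Pn _; apply: le_trans (discrepancy_ge_c_d' d2 iL Pn).
by rewrite lee_fin ge_min lexx orbT.
Qed.
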